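(* Let $n\ge 3$ and let $A=(A_{ij})$ be a real symmetric $n\times n$ matrix with zero diagonal. Let $\widetilde A$ be its pairwise U-centered version, let $a_E=(A_{ij}:i<j)\in\mathbb R^{\binom n2}$, and let $Z$ be the unsigned edge-by-vertex incidence matrix of the complete graph on $\{1,\dots,n\}$. Then the U-centered edge vector $\operatorname{vec}_E(\widetilde A)=(\widetilde A_{ij}:i<j)$ is the least-squares residual from the additive pair model $A_{ij}=u_i+u_j+\varepsilon_{ij}$, $i<j$ (with $u\in\mathbb R^n$ the free parameter); that is, $$\operatorname{vec}_E(\widetilde A)=M_{n,2}\,a_E,\qquad M_{n,2}=I_{\binom n2}-Z(Z^{\mathsf T}Z)^{-1}Z^{\mathsf T}.$$ Moreover, in the parametrization $A_{ij}=\mu+\alpha_i+\alpha_j+\varepsilon_{ij}$, $i<j$, with the constraint $\sum_{i}\alpha_i=0$, the least-squares estimates are $$\widehat\mu=\frac{A_{\cdot\cdot}}{n(n-1)},\qquad \widehat\alpha_i=\frac{A_{i\cdot}-A_{\cdot\cdot}/n}{n-2}\quad(1\le i\le n).$$ Consequently the fitted residual $A_{ij}-\widehat\mu-\widehat\alpha_i-\widehat\alpha_j$ ($i\neq j$) is exactly $\widetilde A_{ij}$.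
   Context: For a symmetric real $n\times n$ matrix $A$ with zero diagonal put $A_{i\cdot}=\sum_{j\ne i}A_{ij}$ and $A_{\cdot\cdot}=\sum_{i\ne j}A_{ij}=2\sum_{i<j}A_{ij}$. For $n\ge3$ the pairwise U-centered array $\widetilde A$ is defined by $$\widetilde A_{ij}=A_{ij}-\frac{A_{i\cdot}+A_{j\cdot}}{n-2}+\frac{A_{\cdot\cdot}}{(n-1)(n-2)}\quad(i\neq j),\qquad \widetilde A_{ii}=0.$$ The coordinates of $\mathbb R^{\binom n2}$ are indexed by the unordered pairs (edges) $\{i,j\}$, $i<j$. The unsigned incidence matrix $Z\in\mathbb R^{\binom n2\times n}$ has entries $Z_{\{i,j\},k}=\mathbf 1\{k\in\{i,j\}\}$. Least squares means minimizing the sum of $\varepsilon_{ij}^2$ over $i<j$. *)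

(* Defs.v *)
From mathcomp Require Import all_boot all_order all_algebra.

Set Implicit Arguments.
Unset Strict Implicit.
Unset Printing Implicit Defensive.

Import Order.TTheory GRing.Theory Num.Theory.
Local Open Scope ring_scope.

Definition edges (n : nat) : {set 'I_n * 'I_n} := [set p : 'I_n * 'I_n | (p.1 < p.2)%N].

Lemma card_edges (n : nat) : #|edges n| = 'C(n, 2).
Proof.
rewrite -sum1_card (eq_bigl (fun p : 'I_n * 'I_n => (p.1 < p.2)%N)); last first.
  by move=> p; rewrite inE.
rewrite -(pair_big_dep xpredT (fun i j : 'I_n => (i < j)%N) (fun _ _ => 1%N)) /=.
rewrite (exchange_big_dep xpredT) //= -bin2_sum big_mkord.
apply: eq_bigr => j _.
by rewrite (big_ord_narrow (ltnW (ltn_ord j))) sum_nat_const card_ord muln1.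
Qed.

(* The coordinates of R^(n choose 2) are the elements e of 'I_#|edges n|:
   coordinate e stands for the pair enum_val e = (i, j) with i < j. *)
Definition vecE (R : pzRingType) (n : nat) (A : 'M[R]_n) : 'cV[R]_#|edges n| :=
  \col_(e < #|edges n|) A (enum_val e).1 (enum_val e).2.

Definition incidence (R : pzRingType) (n : nat) : 'M[R]_(#|edges n|, n) :=
  \matrix_(e < #|edges n|, k < n)
    ((k == (enum_val e).1) || (k == (enum_val e).2))%:R.

(* invmx is a genuine inverse only when Z^T Z is in unitmx. *)
Definition resid_maker (R : fieldType) (n : nat) : 'M[R]_#|edges n| :=
  let Z := incidence R n in 1%:M - Z *m invmx (Z^T *m Z) *m Z^T.

Definition row_total (R : pzRingType) (n : nat) (A : 'M[R]_n) (i : 'I_n) : R :=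
  \sum_(j < n | j != i) A i j.

Definition total (R : pzRingType) (n : nat) (A : 'M[R]_n) : R :=
  \sum_(i < n) \sum_(j < n | j != i) A i j.

Definition Ucenter (R : fieldType) (n : nat) (A : 'M[R]_n) : 'M[R]_n :=
  \matrix_(i < n, j < n)
    if i == j then 0
    else A i j - (row_total A i + row_total A j) / (n%:R - 2)
         + total A / ((n%:R - 1) * (n%:R - 2)).

Definition sum_sq (R : pzRingType) (n : nat) (eps : 'M[R]_n) : R :=
  \sum_(i < n) \sum_(j < n | (i < j)%N) eps i j ^+ 2.

(* t is a least-squares estimate of the parameter of a model with error array
   eps t, the parameter being subject to the constraint C. *)
Definition least_squares (R : realFieldType) (n : nat) (T : Type)
    (C : T -> Prop) (eps : T -> 'M[R]_n) (t : T) : Prop :=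
  C t /\ forall t' : T, C t' -> sum_sq (eps t) <= sum_sq (eps t').

(* Only the off-diagonal entries of the next two arrays are meaningful. *)
Definition pair_error (R : pzRingType) (n : nat) (A : 'M[R]_n)
    (u : 'cV[R]_n) : 'M[R]_n :=
  \matrix_(i < n, j < n) (A i j - (u i 0 + u j 0)).

Definition mean_error (R : pzRingType) (n : nat) (A : 'M[R]_n)
    (p : R * 'cV[R]_n) : 'M[R]_n :=
  \matrix_(i < n, j < n) (A i j - p.1 - p.2 i 0 - p.2 j 0).

Definition centered (R : pzRingType) (n : nat) (p : R * 'cV[R]_n) : Prop :=
  \sum_(i < n) p.2 i 0 = 0.

Definition mu_hat (R : fieldType) (n : nat) (A : 'M[R]_n) : R :=
  total A / (n%:R * (n%:R - 1)).

Definition alpha_hat (R : fieldType) (n : nat) (A : 'M[R]_n) : 'cV[R]_n :=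
  \col_(i < n) ((row_total A i - total A / n%:R) / (n%:R - 2)).

(* Main.v *)
(* Summing over the edges through a vertex shows that Z^T maps the edge vector
   of a symmetric array to its row totals.  The row totals of the U-centered
   array vanish, and that array is A_ij - u_i - u_j for u = mu_hat/2 + alpha_hat,
   so u solves the normal equations.  Since Z^T Z = (n-2) I + J is invertible, u
   is the only least-squares solution, and the residual is M_{n,2} a_E.  The
   centered model is the pair model under the bijective substitution
   u_i = mu/2 + alpha_i. *)
Require Import Defs.
From mathcomp Require Import all_boot all_order all_algebra.
From mathcomp Require Import ring lra.

Set Implicit Arguments.
Unset Strict Implicit.
Unset Printing Implicit Defensive.

Import Order.TTheory GRing.Theory Num.Theory.
Local Open Scope ring_scope.

(** * Squared norms of column vectors and Pythagoras *)

Definition sqnorm (R : pzRingType) (m : nat) (v : 'cV[R]_m) : R :=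
  \sum_(i < m) v i 0 ^+ 2.

Lemma sqnorm_ge0 (R : realFieldType) (m : nat) (v : 'cV[R]_m) : 0 <= sqnorm v.
Proof. by apply: sumr_ge0 => i _; apply: sqr_ge0. Qed.

Lemma sqnorm_le0 (R : realFieldType) (m : nat) (v : 'cV[R]_m) :
  sqnorm v <= 0 -> v = 0.
Proof.
move=> v_le0; have /eqP v0 : sqnorm v == 0 by rewrite eq_le v_le0 sqnorm_ge0.
apply/colP => i; rewrite mxE; apply/eqP; rewrite -sqrf_eq0; apply/eqP.
by apply: (psumr_eq0P _ v0) => // j _; apply: sqr_ge0.
Qed.

Lemma sqnorm_mul (R : comPzRingType) (m : nat) (v : 'cV[R]_m) :
  v^T *m v = (sqnorm v)%:M.
Proof.
apply/matrixP => i j; rewrite !ord1 !mxE eqxx mulr1n.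
by apply: eq_bigr => k _; rewrite mxE expr2.
Qed.

(** The normal equations make the residual at [u0] orthogonal to the column space of [Z], so the
    cross terms vanish. Minimality and uniqueness of the estimate both follow from this identity. *)
Lemma sqnorm_normal (R : comPzRingType) (m n : nat) (Z : 'M[R]_(m, n))
    (a : 'cV[R]_m) (u0 u : 'cV[R]_n) :
  Z^T *m (a - Z *m u0) = 0 ->
  sqnorm (a - Z *m u) = sqnorm (a - Z *m u0) + sqnorm (Z *m (u0 - u)).
Proof.
set r := a - Z *m u0 => Zr0; set d := Z *m (u0 - u).
have -> : a - Z *m u = r + d by rewrite /r /d mulmxBr addrA subrK.
have dr0 : d^T *m r = 0 by rewrite trmx_mul -mulmxA Zr0 mulmx0.
have rd0 : r^T *m d = 0 by rewrite -[d]trmxK -trmx_mul dr0 trmx0.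
clearbody r d; have : (r + d)^T *m (r + d) = r^T *m r + d^T *m d.
  by rewrite [(r + d)^T]raddfD mulmxDl !mulmxDr /= dr0 rd0 addr0 add0r.
rewrite !sqnorm_mul -raddfD => /matrixP/(_ 0 0).
by rewrite !mxE !mulr1n.
Qed.

(** * Sums over edges and the action of the incidence matrix *)

Lemma sum_edges (R : nmodType) (n : nat) (F : 'I_n -> 'I_n -> R) :
  \sum_(e < #|edges n|) F (enum_val e).1 (enum_val e).2
    = \sum_(i < n) \sum_(j < n | (i < j)%N) F i j.
Proof.
rewrite -(big_enum_val (A := mem (edges n)) (fun p => F p.1 p.2)) pair_big_dep /=.
by apply: eq_bigl => p; rewrite inE.
Qed.

Lemma sum_sq_vecE (R : pzRingType) (n : nat) (E : 'M[R]_n) :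
  sum_sq E = sqnorm (vecE E).
Proof.
rewrite /sum_sq -(sum_edges (fun i j => E i j ^+ 2)).
by apply: eq_bigr => e _; rewrite mxE.
Qed.

Lemma incidence_tr_vecE (R : comPzRingType) (n : nat) (B : 'M[R]_n) :
  B^T = B -> (incidence R n)^T *m vecE B = \col_k row_total B k.
Proof.
move=> symB; apply/colP => k; rewrite !mxE.
(* The two endpoints of an edge differ, so the indicator of the disjunction is the sum of two
   indicators, which can be summed separately. *)
pose F (i j : 'I_n) := (k == i)%:R * B i j + (k == j)%:R * B i j.
transitivity (\sum_(e < #|edges n|) F (enum_val e).1 (enum_val e).2).
  apply: eq_bigr => e _; rewrite !mxE /F -mulrDl -natrD; congr (_%:R * _).
  have := enum_valP e; rewrite inE; case: (enum_val e) => i j /= ltij.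
  by case: eqVneq => [->|//]; case: eqVneq ltij => // ->; rewrite ltnn.
rewrite sum_edges /F; under eq_bigr do rewrite big_split.
rewrite big_split /= (bigD1 k) //= [X in _ + X + _]big1 ?addr0; last first.
  by move=> i; rewrite eq_sym => /negPf->; apply: big1 => j _; rewrite mul0r.
rewrite (exchange_big_dep xpredT) //= [X in _ + X](bigD1 k) //=.
rewrite [X in _ + (_ + X)]big1 ?addr0; last first.
  by move=> i; rewrite eq_sym => /negPf->; apply: big1 => j _; rewrite mul0r.
(* Edges with [k] as smaller endpoint give the part [k < j] of the row total; those with [k] as
   larger endpoint give the rest, by symmetry of [B]. *)
rewrite eqxx /row_total [RHS](bigID (fun j : 'I_n => (k < j)%N)) /=.
congr (_ + _).
  apply: eq_big => [j|j _]; last by rewrite mul1r.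
  by case: ltnP; rewrite ?andbF ?andbT // => /gtn_eqF/negbT.
apply: eq_big => [j|j _]; last by rewrite mul1r -{1}symB mxE.
by rewrite -leqNgt ltn_neqAle.
Qed.

Definition pair_sum (R : pzRingType) (n : nat) (u : 'cV[R]_n) : 'M[R]_n :=
  \matrix_(i, j) (u i 0 + u j 0).

Lemma incidence_mul (R : pzRingType) (n : nat) (u : 'cV[R]_n) :
  incidence R n *m u = vecE (pair_sum u).
Proof.
apply/colP => e; rewrite !mxE; under eq_bigr do rewrite mxE.
have := enum_valP e; rewrite inE; case: (enum_val e) => i j /= ltij.
have neij : j != i by case: eqVneq ltij => // ->; rewrite ltnn.
rewrite (bigD1 i) //= (bigD1 j) //= big1 ?addr0; last first.
  move=> k /andP[/negPf ki /negPf kj].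
  by rewrite ki kj mul0r.
by rewrite !eqxx orbT !mul1r.
Qed.

Lemma vecE_pair_error (R : pzRingType) (n : nat) (A : 'M[R]_n) (u : 'cV[R]_n) :
  vecE (pair_error A u) = vecE A - incidence R n *m u.
Proof. by rewrite incidence_mul; apply/colP => e; rewrite !mxE. Qed.

Lemma sum_neq (R : zmodType) (n : nat) (F : 'I_n -> R) (i : 'I_n) :
  \sum_(j | j != i) F j = \sum_j F j - F i.
Proof. by rewrite [X in _ = X - _](bigD1 i) //= addrC addrK. Qed.

(** This is Z^T Z = (n-2) I + J read along row [i]; the subtracted term is the diagonal entry of
    [pair_sum u]. *)
Lemma row_total_pair_sum (R : pzRingType) (n : nat) (u : 'cV[R]_n) (i : 'I_n) :
  row_total (pair_sum u) i = u i 0 *+ n + \sum_j u j 0 - u i 0 *+ 2.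
Proof.
rewrite /row_total sum_neq; under eq_bigr do rewrite mxE.
by rewrite big_split /= sumr_const card_ord mxE mulr2n.
Qed.

(** * Invertibility of the Gram matrix *)

Section LeastSquares.
Variables (R : realFieldType) (n : nat).
Hypothesis hn : (3 <= n)%N.
Implicit Types A : 'M[R]_n.

Local Notation N := (n%:R : R).
Local Notation Z := (incidence R n).

Lemma natr_ge3 : 3 <= N. Proof. by rewrite (ler_nat R 3 n). Qed.

Lemma natr_neq0 : [/\ N != 0, N - 1 != 0 & N - 2 != 0].
Proof. by have := natr_ge3; split; apply/eqP; lra. Qed.

Lemma gram_inj (u : 'cV[R]_n) : Z^T *m Z *m u = 0 -> u = 0.
Proof.
have [N0 N1 N2] := natr_neq0.
rewrite -mulmxA incidence_mul incidence_tr_vecE => [|]; last first.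
  by apply/matrixP => i j; rewrite !mxE addrC.
set S := \sum_j u j 0.
move=> /colP ZZu0; have eq_u i : (N - 2) * u i 0 = - S.
  have := ZZu0 i; rewrite !mxE row_total_pair_sum -/S.
  rewrite -mulr_natl -[u i 0 *+ 2]mulr_natl => h.
  by rewrite mulrBl; lra.
(* Summing (n-2) u_i = -S over i gives (n-2) S = -n S, that is 2 (n-1) S = 0. *)
have S0 : S = 0.
  have : (N - 2) * S = N * - S.
    rewrite mulr_sumr (eq_bigr (fun=> - S)) => [|i _]; last exact: eq_u.
    by rewrite sumr_const card_ord mulr_natl.
  move=> h; have /eqP : (2 * (N - 1)) * S = 0 by lra.
  by rewrite mulf_eq0 mulf_eq0 pnatr_eq0 (negPf N1) => /eqP.
apply/colP => i; rewrite mxE; apply: (mulfI N2).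
by rewrite eq_u S0 oppr0 mulr0.
Qed.

Lemma gram_unit : Z^T *m Z \in unitmx.
Proof.
(* Row-freeness concerns the left kernel; transposing turns it into the right kernel treated by
   [gram_inj]. *)
rewrite -unitmx_tr -row_free_unit -kermx_eq0.
apply/rowV0P => v /sub_kermxP vG0; rewrite -[v]trmxK (gram_inj (u := v^T)) ?trmx0 //.
by rewrite -[LHS]trmxK trmx_mul trmxK vG0 trmx0.
Qed.

Lemma incidence_inj (u : 'cV[R]_n) : Z *m u = 0 -> u = 0.
Proof. by move=> Zu0; apply: gram_inj; rewrite -mulmxA Zu0 mulmx0. Qed.

(** * U-centering as a residual with vanishing row totals *)

Lemma row_total_Ucenter A (i : 'I_n) : row_total (Ucenter A) i = 0.
Proof.
have [N0 N1 N2] := natr_neq0.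
rewrite /row_total.
under eq_bigr => j ne_ji do rewrite mxE eq_sym (negPf ne_ji).
have card_neq c : \sum_(j < n | j != i) c = (N - 1) * c.
  by rewrite sum_neq sumr_const card_ord mulrBl mul1r mulr_natl.
rewrite big_split big_split /= sumrN -mulr_suml big_split /= !card_neq.
rewrite (sum_neq (row_total A)) -[\sum_j row_total A j]/(Defs.total A).
rewrite -/(row_total A i).
(* With r the row total and T the total: r - ((n-1) r + (T - r))/(n-2) + T/(n-2) = 0. *)
by field; rewrite N2.
Qed.

Lemma residual_eq_Ucenter A (i j : 'I_n) : i != j ->
  A i j - mu_hat A - alpha_hat A i 0 - alpha_hat A j 0 = Ucenter A i j.
Proof.
have [N0 N1 N2] := natr_neq0.
(* The coefficients of the total agree because 2/(n(n-2)) - 1/(n(n-1)) = 1/((n-1)(n-2)). *)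
move=> /negPf ne_ij; rewrite !mxE ne_ij /mu_hat; field.
by rewrite N0 N1 N2.
Qed.

Lemma sum_alpha_hat A : \sum_i alpha_hat A i 0 = 0.
Proof.
have [N0 N1 N2] := natr_neq0.
under eq_bigr do rewrite mxE.
rewrite -mulr_suml big_split /= sumrN sumr_const card_ord -/(Defs.total A).
by rewrite -(mulr_natl (_ / _) n) mulrCA divff // mulr1 subrr mul0r.
Qed.

(** * Passage between the centered model and the pair model *)

Definition pair_param (p : R * 'cV[R]_n) : 'cV[R]_n := const_mx (p.1 / 2) + p.2.

Lemma pair_error_param A p : pair_error A (pair_param p) = mean_error A p.
Proof. by apply/matrixP => i j; rewrite !mxE; field. Qed.

Lemma sum_pair_param p : centered p -> \sum_i pair_param p i 0 = N * (p.1 / 2).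
Proof.
move=> cp; under eq_bigr do rewrite !mxE.
by rewrite big_split /= cp addr0 sumr_const card_ord mulr_natl.
Qed.

(** Under the constraint, the sum of the u_i is n mu/2, which recovers mu and then alpha. *)
Lemma pair_param_inj p q :
  centered p -> centered q -> pair_param p = pair_param q -> p = q.
Proof.
have [N0 _ _] := natr_neq0.
move=> cp cq eq_pq; have eq1 : p.1 = q.1.
  have := sum_pair_param cp; rewrite eq_pq (sum_pair_param cq) => /(mulfI N0).
  by move/(mulIf _) => -> //; rewrite invr_eq0 pnatr_eq0.
by case: p q eq1 eq_pq {cp cq} => [m a] [m' a'] /= -> /addrI /= ->.
Qed.

Lemma pair_param_surj u : exists2 p, centered p & pair_param p = u.
Proof.
have [N0 _ _] := natr_neq0.
pose m := (\sum_i u i 0) / N.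
(* Centering forces mu/2 to be the mean [m] of [u]. *)
exists (2 * m, u - const_mx m).
  rewrite /centered /=; under eq_bigr do rewrite !mxE.
  rewrite big_split /= sumrN sumr_const card_ord -(mulr_natl m n) mulrCA.
  by rewrite divff // mulr1 subrr.
by apply/colP => i; rewrite !mxE /=; field.
Qed.

Lemma vecE_residual A :
  vecE (pair_error A (pair_param (mu_hat A, alpha_hat A))) = vecE (Ucenter A).
Proof.
rewrite pair_error_param; apply/colP => e; rewrite [LHS]mxE [RHS]mxE [LHS]mxE.
apply: residual_eq_Ucenter.
by have := enum_valP e; rewrite inE; case: eqVneq => // ->; rewrite ltnn.
Qed.

(** * Least squares for a symmetric array *)

Section Symmetric.
Variable A : 'M[R]_n.
Hypothesis symA : A^T = A.

Local Notation u_hat := (pair_param (mu_hat A, alpha_hat A)).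

Lemma normal_equations : Z^T *m (vecE A - Z *m u_hat) = 0.
Proof.
rewrite -vecE_pair_error vecE_residual incidence_tr_vecE.
  by apply/colP => i; rewrite !mxE row_total_Ucenter.
apply/matrixP => i j; rewrite !mxE eq_sym; case: eqP => // _.
by rewrite -{1}symA mxE [row_total A j + _]addrC.
Qed.

Lemma resid_maker_vecE : resid_maker R n *m vecE A = vecE (Ucenter A).
Proof.
rewrite -vecE_residual vecE_pair_error /resid_maker mulmxBl mul1mx -!mulmxA.
congr (_ - _ *m _).
(* The normal equations express Z^T a through the Gram matrix, which its inverse then cancels. *)
have -> : Z^T *m vecE A = Z^T *m Z *m u_hat.
  by apply/eqP; rewrite -subr_eq0 -mulmxA -mulmxBr normal_equations.
by rewrite mulKmx // gram_unit.
Qed.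

(** By Pythagoras, [v] exceeds the minimum by the squared norm of Z ([u_hat] - v), which is zero
    only at [u_hat] since Z is injective. *)
Lemma least_squares_pairP u :
  least_squares (fun=> True) (pair_error A) u <-> u = u_hat.
Proof.
have sumE v : sum_sq (pair_error A v)
    = sqnorm (vecE A - Z *m u_hat) + sqnorm (Z *m (u_hat - v)).
  by rewrite sum_sq_vecE vecE_pair_error (sqnorm_normal _ normal_equations).
split=> [[_ /(_ u_hat I)] | ->].
  rewrite !sumE lerD2l subrr mulmx0 [sqnorm 0]big1 => [|i _]; last first.
    by rewrite mxE expr0n.
  by move=> /sqnorm_le0/incidence_inj/eqP; rewrite subr_eq0 => /eqP.
split=> // v _; rewrite !sumE lerD2l subrr mulmx0 [sqnorm 0]big1 ?sqnorm_ge0 //.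
by move=> i _; rewrite mxE expr0n.
Qed.

Lemma least_squares_centeredP p :
  least_squares (@centered R n) (mean_error A) p
  <-> p = (mu_hat A, alpha_hat A).
Proof.
have c_hat : centered (mu_hat A, alpha_hat A) by apply: sum_alpha_hat.
split=> [[cp minp] | ->].
  (* Every [v] comes from a centered parameter, so a centered minimizer also minimizes over all of
     R^n. *)
  apply: pair_param_inj => //; apply/least_squares_pairP; split=> // v _.
  by have [q cq <-] := pair_param_surj v; rewrite !pair_error_param minp.
split=> // q _; rewrite -!pair_error_param.
by have [_] := (least_squares_pairP u_hat).2 erefl; apply.
Qed.

End Symmetric.
End LeastSquares.

Theorem theorem2p2 (R : realFieldType) (n : nat) (A : 'M[R]_n)
    (hn : (3 <= n)%N) (hsym : A^T = A) (hdiag : forall i : 'I_n, A i i = 0) :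
  [/\ (exists u : 'cV[R]_n,
         least_squares (fun _ : 'cV[R]_n => True) (pair_error A) u)
      /\ (forall u : 'cV[R]_n,
            least_squares (fun _ : 'cV[R]_n => True) (pair_error A) u ->
            vecE (Ucenter A) = vecE (pair_error A u)),
      (incidence R n)^T *m incidence R n \in unitmx
      /\ vecE (Ucenter A) = resid_maker R n *m vecE A,
      forall (mu : R) (alpha : 'cV[R]_n),
        least_squares (@centered R n) (mean_error A) (mu, alpha)
        <-> mu = mu_hat A /\ alpha = alpha_hat A
    & forall i j : 'I_n, i != j ->
        A i j - mu_hat A - alpha_hat A i 0 - alpha_hat A j 0 = Ucenter A i j].
Proof.
split.
- split.
    by exists (pair_param (mu_hat A, alpha_hat A)); apply/least_squares_pairP.
  by move=> u /(least_squares_pairP hn hsym) ->; rewrite vecE_residual.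
- by split; [apply: gram_unit | rewrite resid_maker_vecE].
- move=> mu alpha; split=> [/(least_squares_centeredP hn hsym)[-> ->] //|].
  by move=> [-> ->]; apply/least_squares_centeredP.
- exact: residual_eq_Ucenter.
Qed.
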